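(* Let $\mathcal{X}_1$ and $\mathcal{X}_2$ be two fuzzy graphs with $m$ and $n$ vertices respectively, and let $\mathcal{X}=\mathcal{X}_1+\mathcal{X}_2$ be the join of $\mathcal{X}_1$ and $\mathcal{X}_2$. If $D\subset V(\mathcal{X}_1)$ is not a strong dominating set of $\mathcal{X}_1$, then $D$ is not a strong dominating set of $\mathcal{X}$.
   Context: A fuzzy graph $\mathcal{X}=(\mathcal{V},\varrho,\upsilon)$ consists of a nonempty finite set $\mathcal{V}=V(\mathcal{X})$ of vertices, a function $\varrho:\mathcal{V}\to[0,1]$ and a symmetric function $\upsilon:\mathcal{V}\times\mathcal{V}\to[0,1]$ with $\upsilon(ab)\le\min(\varrho(a),\varrho(b))$ for all $a,b$, and no loops ($\upsilon(aa)=0$). It is assumed that $\varrho(a)>0$ for all $a\in\mathcal{V}$; pairs $ab$ with $\upsilon(ab)>0$ are called edges. The join $\mathcal{X}_1+\mathcal{X}_2$ of fuzzy graphs $\mathcal{X}_1=(\mathcal{V}_1,\varrho_1,\upsilon_1)$ and $\mathcal{X}_2=(\mathcal{V}_2,\varrho_2,\upsilon_2)$ with $\mathcal{V}_1\cap\mathcal{V}_2=\emptyset$ has vertex set $\mathcal{V}_1\cup\mathcal{V}_2$, $\varrho(a)=\varrho_i(a)$ for $a\in\mathcal{V}_i$, $\upsilon(ab)=\upsilon_i(ab)$ for $a,b\in\mathcal{V}_i$, and $\upsilon(ab)=\min(\varrho(a),\varrho(b))$ for $a\in\mathcal{V}_1$, $b\in\mathcal{V}_2$. A path is a sequence of distinct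 vertices $a_1,\dots,a_k$ with $\upsilon(a_ia_{i+1})>0$ for all $i<k$; its strength is the minimum of the weights $\upsilon$ of its edges. The strength of connectedness between $a$ and $b$ is the maximum of the strengths of all paths from $a$ to $b$ (and $0$ if there is none). An edge $ab$ is strong if $\upsilon(ab)$ is at least the strength of connectedness between $a$ and $b$ in the fuzzy graph obtained by deleting the edge $ab$. A set $\mathcal{D}\subseteq\mathcal{V}$ is a strong dominating set of $\mathcal{X}$ if every $b\in\mathcal{V}\setminus\mathcal{D}$ is joined by a strong edge of $\mathcal{X}$ to some $a\in\mathcal{D}$. *)

(* Defs.v *)
From mathcomp Require Import all_boot all_order all_algebra.
From mathcomp Require Import reals.

Set Implicit Arguments.
Unset Strict Implicit.
Unset Printing Implicit Defensive.

Import Order.TTheory GRing.Theory Num.Theory.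
Local Open Scope ring_scope.

(* Positivity of [vweight] is the standing assumption that every element of
   the carrier really is a vertex; [eweight <= 1] follows from [eweight_le]. *)
Record fuzzy_graph (R : realType) (V : finType) := FuzzyGraph {
  vweight : V -> R;
  eweight : V -> V -> R;
  fuzzy_nonempty : (0 < #|V|)%N;
  vweight_gt0 : forall a, 0 < vweight a;
  vweight_le1 : forall a, vweight a <= 1;
  eweight_ge0 : forall a b, 0 <= eweight a b;
  eweight_le : forall a b, eweight a b <= Num.min (vweight a) (vweight b);
  eweight_sym : forall a b, eweight a b = eweight b a;
  eweight_irr : forall a, eweight a a = 0
}.

Section Strength.
Variables (R : realType) (V : finType) (X : fuzzy_graph R V).

(* As in [path], a vertex sequence is given by its head [a] and its tail [p]. *)
Definition fuzzy_path (a b : V) (p : seq V) : bool :=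
  [&& path (fun x y => 0 < eweight X x y) a p, uniq (a :: p) & last a p == b].

(* Edge weights are at most 1, so the index 1 does not affect the minimum when
   there is at least one edge; the edgeless path gets strength 1. *)
Definition path_strength (a : V) (p : seq V) : R :=
  \big[Num.min/1]_(w <- pairmap (eweight X) a p) w.

(* The range of [k] loses no path: [uniq (a :: p)] forces [size p < #|V|]. *)
Definition connectedness (a b : V) : R :=
  \big[Num.max/0]_(k < #|V|)
    \big[Num.max/0]_(p : k.-tuple V | fuzzy_path a b p) path_strength a p.

End Strength.

Section DeleteEdge.
Variables (R : realType) (V : finType) (X : fuzzy_graph R V) (a b : V).

Definition del_eweight (x y : V) : R :=
  if [set x; y] == [set a; b] then 0 else eweight X x y.

Fact del_eweight_ge0 x y : 0 <= del_eweight x y.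
Proof. by rewrite /del_eweight; case: ifP => // _; apply: eweight_ge0. Qed.

Fact del_eweight_le x y :
  del_eweight x y <= Num.min (vweight X x) (vweight X y).
Proof.
rewrite /del_eweight; case: ifP => _; last exact: eweight_le.
by rewrite le_min !ltW ?vweight_gt0.
Qed.

Fact del_eweight_sym x y : del_eweight x y = del_eweight y x.
Proof. by rewrite /del_eweight setUC eweight_sym. Qed.

Fact del_eweight_irr x : del_eweight x x = 0.
Proof. by rewrite /del_eweight eweight_irr if_same. Qed.

Definition delete_edge : fuzzy_graph R V :=
  FuzzyGraph (fuzzy_nonempty X) (vweight_gt0 X) (vweight_le1 X)
    del_eweight_ge0 del_eweight_le del_eweight_sym del_eweight_irr.

End DeleteEdge.

Definition strong_edge (R : realType) (V : finType) (X : fuzzy_graph R V)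
    (a b : V) : bool :=
  (0 < eweight X a b) &&
  (connectedness (delete_edge X a b) a b <= eweight X a b).

Definition strong_dominating (R : realType) (V : finType)
    (X : fuzzy_graph R V) (D : {set V}) : Prop :=
  forall b, b \notin D -> exists2 a, a \in D & strong_edge X a b.

(* The sum type [V1 + V2] is the union of two disjoint vertex sets. *)
Section Join.
Variables (R : realType) (V1 V2 : finType).
Variables (X1 : fuzzy_graph R V1) (X2 : fuzzy_graph R V2).

Definition join_vweight (a : V1 + V2) : R :=
  match a with inl a1 => vweight X1 a1 | inr a2 => vweight X2 a2 end.

Definition join_eweight (a b : V1 + V2) : R :=
  match a, b with
  | inl a1, inl b1 => eweight X1 a1 b1
  | inr a2, inr b2 => eweight X2 a2 b2
  | _, _ => Num.min (join_vweight a) (join_vweight b)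
  end.

Fact join_nonempty : (0 < #|{: V1 + V2}|)%N.
Proof. by rewrite card_sum addn_gt0 (fuzzy_nonempty X1). Qed.

Fact join_vweight_gt0 a : 0 < join_vweight a.
Proof. by case: a => a /=; apply: vweight_gt0. Qed.

Fact join_vweight_le1 a : join_vweight a <= 1.
Proof. by case: a => a /=; apply: vweight_le1. Qed.

Fact join_eweight_ge0 a b : 0 <= join_eweight a b.
Proof.
by case: a b => [a|a] [b|b] /=; rewrite ?eweight_ge0 // le_min !ltW ?vweight_gt0.
Qed.

Fact join_eweight_le a b :
  join_eweight a b <= Num.min (join_vweight a) (join_vweight b).
Proof. by case: a b => [a|a] [b|b] //=; apply: eweight_le. Qed.

Fact join_eweight_sym a b : join_eweight a b = join_eweight b a.
Proof. by case: a b => [a|a] [b|b] /=; rewrite ?(eweight_sym _ a) // minC. Qed.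

Fact join_eweight_irr a : join_eweight a a = 0.
Proof. by case: a => a /=; apply: eweight_irr. Qed.

Definition fuzzy_join : fuzzy_graph R (V1 + V2)%type :=
  FuzzyGraph join_nonempty join_vweight_gt0 join_vweight_le1
    join_eweight_ge0 join_eweight_le join_eweight_sym join_eweight_irr.

End Join.

(* Main.v *)
(** The inclusion of [X1] into the join preserves edge weights and commutes with
deleting an edge.  A weight-preserving injection carries paths to paths of the
same strength, so it can only increase the strength of connectedness; hence an
edge of [X1] that is strong in the join is already strong in [X1].  Applying
this to the vertices of [X1] outside [D] gives the contrapositive. *)

Require Import Defs.
From mathcomp Require Import all_boot all_order all_algebra.
From mathcomp Require Import reals.

Import Order.TTheory.

Section Embedding.
Variables (R : realType) (V W : finType).
Variables (X : fuzzy_graph R V) (Y : fuzzy_graph R W) (f : V -> W).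
Hypothesis f_inj : injective f.
Hypothesis eweight_f : forall x y, eweight Y (f x) (f y) = eweight X x y.

Lemma fuzzy_path_map (a b : V) (p : seq V) :
  fuzzy_path Y (f a) (f b) (map f p) = fuzzy_path X a b p.
Proof.
rewrite /fuzzy_path -map_cons map_inj_uniq // last_map inj_eq // path_map.
by congr [&& _, _ & _]; apply: eq_path => x y /=; rewrite eweight_f.
Qed.

Lemma path_strength_map (a : V) (p : seq V) :
  path_strength Y (f a) (map f p) = path_strength X a p.
Proof.
(* Both minima run over the same list of edge weights. *)
rewrite /path_strength; congr bigop; elim: p a => //= x p IHp a.
by rewrite eweight_f IHp.
Qed.

Lemma connectedness_embed (a b : V) :
  (connectedness X a b <= connectedness Y (f a) (f b))%R.
Proof.
rewrite /connectedness; apply: bigmax_le => [|k _]; first exact: bigmax_ge_id.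
apply: bigmax_le => [|p pP]; first exact: bigmax_ge_id.
(* Injectivity keeps the length [k] within the index range for [W], so the image of [p] is one of
   the paths counted on the right. *)
have leVW : (#|V| <= #|W|)%N := leq_card f f_inj.
apply: (bigmax_sup (widen_ord leVW k)) => //=.
apply: (bigmax_sup (map_tuple f p)); first by rewrite fuzzy_path_map.
by rewrite path_strength_map.
Qed.

End Embedding.

(** Injectivity of [f] on subsets ensures that only the pair [{a, b}] is sent to the deleted pair
    [{f a, f b}]. *)
Lemma del_eweight_inj (R : realType) (V W : finType) (X : fuzzy_graph R V)
    (Y : fuzzy_graph R W) (f : V -> W) (a b x y : V) :
  injective f ->
  (forall u v, eweight Y (f u) (f v) = eweight X u v) ->
  del_eweight Y (f a) (f b) (f x) (f y) = del_eweight X a b x y.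
Proof.
move=> f_inj eweight_f; rewrite /del_eweight eweight_f.
have imset_pair u v : [set f u; f v] = f @: [set u; v] by rewrite imsetU1 imset_set1.
by rewrite !imset_pair (inj_eq (imset_inj f_inj)).
Qed.

Lemma strong_edge_embed (R : realType) (V W : finType) (X : fuzzy_graph R V)
    (Y : fuzzy_graph R W) (f : V -> W) (a b : V) :
  injective f ->
  (forall x y, eweight Y (f x) (f y) = eweight X x y) ->
  strong_edge Y (f a) (f b) -> strong_edge X a b.
Proof.
move=> f_inj eweight_f /andP[]; rewrite eweight_f => ab_gt0 leY.
rewrite /strong_edge ab_gt0; apply: le_trans leY.
(* [f] also embeds the two edge-deleted graphs. *)
by apply: connectedness_embed => // x y; apply: del_eweight_inj.
Qed.

Theorem theorem4p22 (R : realType) (m n : nat) (V1 V2 : finType)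
    (X1 : fuzzy_graph R V1) (X2 : fuzzy_graph R V2)
    (cardV1 : #|V1| = m) (cardV2 : #|V2| = n) (D : {set V1}) :
  ~ strong_dominating X1 D ->
  ~ strong_dominating (fuzzy_join X1 X2) [set inl a | a in D].
Proof.
have inl_inj : injective (@inl V1 V2) by move=> x y [].
move=> ndomD domD; apply: ndomD => b bND.
(* The vertex dominating [inl b] lies in the image of [D], so both ends of the strong edge come from
   [X1]. *)
have [|_ /imsetP[a aD ->] strong_ab] := domD (inl b); first by rewrite mem_imset.
by exists a => //; apply: strong_edge_embed strong_ab.
Qed.
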